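(* Let $RR$ be a $Jf$-relative monad, $LM$ a left $RR$-module with values in sets, and $C(RR,LM)$ the associated C-system. The function $$mb_{RR,LM}:\widetilde{Ob}(C(RR,LM))\to\coprod_{n\in\mathbb N}Ob_{n+1}(RR,LM)\times RR(n),$$ which sends $s:ft(X)\to X$ with $X=(n+1,\Gamma)$ (so $s\in RR(n+1,n)$) to $(n,(\Gamma,s(n)))$, is a bijection. Its inverse is the function $mb^!_{RR,LM}$ which sends $(n,(\Gamma,o))$, with $\Gamma\in Ob_{n+1}(RR,LM)$ and $o\in RR(n)$, to the morphism $(x_0^n,\dots,x_{n-1}^n,o)$ from $ft((n+1,\Gamma))$ to $(n+1,\Gamma)$; in particular this morphism belongs to $\widetilde{Ob}(C(RR,LM))$.
   Context: Composition is in diagrammatic order: $f\circ g$ means first $f$, then $g$. $stn(n)=\{0,\dots,n-1\}$, $Fun(X,Y)$ is the set of functions $X\to Y$, $F(m,n)=Fun(stn(m),stn(n))$. A $Jf$-relative monad $RR$ consists of sets $RR(n)$ ($n\in\mathbb N$), functions $\eta(n):stn(n)\to RR(n)$, and for each $f\in RR(m,n):=Fun(stn(m),RR(n))$ a function $\rho(f):RR(m)\to RR(n)$, such that $\rho(\eta(n))=Id_{RR(n)}$, $\eta(m)\circ\rho(f)=f$ and $\rho(f)\circ\rho(g)=\rho(f\circ\rho(g))$ for $f\in RR(l,m)$, $g\in RR(m,n)$. Elements $f\in RR(m,n)$ are written as sequences $(f(0),\dots,f(m-1))$. The Kleisli category has objects $\mathbb N$, morphisms $m\to n$ the elements of $RR(m,n)$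 (tagged by $m,n$), composition $f\circ_T g=f\circ\rho(g)$ and identities $\eta(m)$. For $f\in F(m,n)$ put $L(f)=f\circ\eta(n)$ and, for $x\in RR(m)$, $f(x):=\rho(L(f))(x)$. Put $x_i^n=\eta(n)(i)\in RR(n)$; $\iota_n^1:stn(n)\to stn(n+1)$ is $j\mapsto j$. For $f\in RR(n,m)$, $qq(f)=(\iota_m^1(f(0)),\dots,\iota_m^1(f(n-1)),x_m^{m+1})\in RR(n+1,m+1)$. A left $RR$-module $LM$ with values in sets is a covariant functor from the Kleisli category to sets; for $f\in RR(n,m)$ and $E\in LM(n)$ write $f(E)\in LM(m)$ for the action. The C-system $C(RR,LM)$ is the following category with additional structure. $Ob_n(RR,LM)=LM(0)\times\dots\times LM(n-1)$; objects are pairs $(n,\Gamma)$ with $\Gamma=(T_0,\dots,T_{n-1})\in Ob_n(RR,LM)$. Morphisms $(m,\Gamma)\to(n,\Gamma')$ are elements of $RR(n,m)$ (tagged by domain and codomain); the composite of $f:(l,\Gamma)\to(m,\Gamma')$ and $g:(m,\Gamma')\to(n,\Gamma'')$ is $g\circ_T f$; identities are $\eta(n)$. Length $l(n,\Gamma)=n$, $pt=(0,())$, $ft(n+1,(T_0,\dots,T_n))=(n,(T_0,\dots,T_{n-1}))$, $ft(pt)=pt$, $p_{(n+1,\Gamma)}=(x_0^{n+1},\dots,x_{n-1}^{n+1}):(n+1,\Gamma)\to ft(n+1,\Gamma)$. For $X=(m,(T_0,\dots,T_{m-1}))$, $Y=(n+1,(T'_0,\dots,T'_n))$ and $f:X\to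 ft(Y)$: $f^*(Y)=(m+1,(T_0,\dots,T_{m-1},f(T'_n)))$ and $q(f,Y)=qq(f):f^*(Y)\to Y$. $\widetilde{Ob}(C(RR,LM))$ is the set of morphisms $s:ft(X)\to X$ with $l(X)>0$ and $s\circ p_X=Id_{ft(X)}$. *)

(* Defs.v *)
From mathcomp Require Import all_boot.

Set Implicit Arguments.
Unset Strict Implicit.
Unset Printing Implicit Defensive.

(* Composition in categories is written in diagrammatic order: [ccomp f g] is
   first [f], then [g].  On functions [\o] is the usual (right to left)
   composition, so the diagrammatic composite of f and g is [g \o f]. *)

Record category := Category {
  cob :> Type;
  chom : cob -> cob -> Type;
  cid : forall X, chom X X;
  ccomp : forall X Y Z, chom X Y -> chom Y Z -> chom X Z;
  cidl : forall X Y (f : chom X Y), ccomp (cid X) f = f;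
  cidr : forall X Y (f : chom X Y), ccomp f (cid Y) = f;
  ccompA : forall X Y Z W (f : chom X Y) (g : chom Y Z) (h : chom Z W),
    ccomp (ccomp f g) h = ccomp f (ccomp g h) }.

Record setFunctor (C : category) := SetFunctor {
  fob :> C -> Type;
  fmap : forall X Y, chom X Y -> fob X -> fob Y;
  fmap_id : forall X, fmap (cid X) = id;
  fmap_comp : forall X Y Z (f : chom X Y) (g : chom Y Z),
    fmap (ccomp f g) = fmap g \o fmap f }.

(* Jf-relative monads; stn(n) is 'I_n and RR(m,n) is ['I_m -> RR n]. *)

Record relMonad := RelMonad {
  rm :> nat -> Type;
  eta : forall n, 'I_n -> rm n;
  rho : forall m n, ('I_m -> rm n) -> rm m -> rm n;
  rho_eta : forall n, rho (@eta n) = id;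
  eta_rho : forall m n (f : 'I_m -> rm n), rho f \o @eta m = f;
  rho_rho : forall l m n (f : 'I_l -> rm m) (g : 'I_m -> rm n),
    rho g \o rho f = rho (rho g \o f) }.

Arguments eta : clear implicits.

Definition kleisli_comp (RR : relMonad) l m n
    (f : 'I_l -> RR m) (g : 'I_m -> RR n) : 'I_l -> RR n :=
  rho g \o f.

Lemma kleisli_idl (RR : relMonad) m n (f : 'I_m -> RR n) :
  kleisli_comp (eta RR m) f = f.
Proof. exact: eta_rho. Qed.

Lemma kleisli_idr (RR : relMonad) m n (f : 'I_m -> RR n) :
  kleisli_comp f (eta RR n) = f.
Proof. by rewrite /kleisli_comp rho_eta. Qed.

Lemma kleisli_compA (RR : relMonad) k l m n
    (f : 'I_k -> RR l) (g : 'I_l -> RR m) (h : 'I_m -> RR n) :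
  kleisli_comp (kleisli_comp f g) h = kleisli_comp f (kleisli_comp g h).
Proof. by rewrite /kleisli_comp -rho_rho. Qed.

Definition kleisli (RR : relMonad) : category :=
  @Category nat (fun m n => 'I_m -> RR n) (eta RR) (@kleisli_comp RR)
    (@kleisli_idl RR) (@kleisli_idr RR) (@kleisli_compA RR).

Definition leftModule (RR : relMonad) := setFunctor (kleisli RR).

Definition act (RR : relMonad) (LM : leftModule RR) n m (f : 'I_n -> RR m)
    (E : LM n) : LM m :=
  @fmap (kleisli RR) LM n m f E.

(* L(f), and the action x |-> f(x) of a function f : stn(m) -> stn(n) on RR. *)
Definition Lfun (RR : relMonad) m n (f : 'I_m -> 'I_n) : 'I_m -> RR n :=
  eta RR n \o f.

Definition ren (RR : relMonad) m n (f : 'I_m -> 'I_n) (x : RR m) : RR n :=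
  rho (Lfun RR f) x.

Definition iota1 n : 'I_n -> 'I_n.+1 := widen_ord (leqnSn n).

(* The sequence (f 0, ..., f (n-1), a); for j : 'I_n, [lift ord_max j] has
   value j. *)
Definition snoc (T : Type) n (f : 'I_n -> T) (a : T) : 'I_n.+1 -> T :=
  fun i => if unlift ord_max i is Some j then f j else a.

Definition qq (RR : relMonad) n m (f : 'I_n -> RR m) : 'I_n.+1 -> RR m.+1 :=
  snoc (fun i => ren (@iota1 m) (f i)) (eta RR m.+1 ord_max).

(* The operations of a C-system on a category.  The C-system axioms are not
   bundled: the set [tOb] below depends on the operations only. *)

Record csystemData := CSystemData {
  cs_cat :> category;
  len : cs_cat -> nat;
  pt : cs_cat;
  ft : cs_cat -> cs_cat;
  pr : forall X : cs_cat, chom X (ft X);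
  pullOb : forall X Y : cs_cat, 0 < len Y -> chom X (ft Y) -> cs_cat;
  pullq : forall (X Y : cs_cat) (posY : 0 < len Y) (f : chom X (ft Y)),
    chom (pullOb posY f) Y }.

Definition in_tOb (C : csystemData) (X : C) (s : chom (ft X) X) : Prop :=
  0 < len X /\ ccomp s (pr X) = cid (ft X).

(* A morphism ft(X) -> X carries its codomain X, hence the sum over X. *)
Definition tOb (C : csystemData) : Type :=
  {X : C & {s : chom (ft X) X | in_tOb s}}.

(* LM(0) * ... * LM(n-1), associated to the left: (T_0, ..., T_n) is the pair
   of (T_0, ..., T_{n-1}) and T_n. *)
Fixpoint Obn (RR : relMonad) (LM : leftModule RR) (n : nat) : Type :=
  if n is k.+1 then (Obn LM k * LM k)%type else unit.

Definition CRL_ob (RR : relMonad) (LM : leftModule RR) : Type :=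
  {n : nat & Obn LM n}.

Definition CRL_len (RR : relMonad) (LM : leftModule RR) (X : CRL_ob LM) : nat :=
  projT1 X.

Definition mkOb (RR : relMonad) (LM : leftModule RR) n (G : Obn LM n) :
    CRL_ob LM :=
  existT _ n G.

Definition CRL_hom (RR : relMonad) (LM : leftModule RR) (X Y : CRL_ob LM) :
    Type :=
  'I_(CRL_len Y) -> RR (CRL_len X).

Definition CRL_id (RR : relMonad) (LM : leftModule RR) (X : CRL_ob LM) :
    CRL_hom X X :=
  eta RR (CRL_len X).

Definition CRL_comp (RR : relMonad) (LM : leftModule RR) (X Y Z : CRL_ob LM)
    (f : CRL_hom X Y) (g : CRL_hom Y Z) : CRL_hom X Z :=
  kleisli_comp g f.

Definition CRL_cat (RR : relMonad) (LM : leftModule RR) : category :=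
  @Category (CRL_ob LM) (@CRL_hom RR LM) (@CRL_id RR LM) (@CRL_comp RR LM)
    (fun X Y f => kleisli_idr f) (fun X Y f => kleisli_idl f)
    (fun X Y Z W f g h => esym (kleisli_compA h g f)).

Definition CRL_pt (RR : relMonad) (LM : leftModule RR) : CRL_ob LM :=
  @mkOb RR LM 0 tt.

Definition CRL_ft (RR : relMonad) (LM : leftModule RR) (X : CRL_ob LM) :
    CRL_ob LM :=
  match X with
  | existT 0 _ => CRL_pt LM
  | existT n.+1 G => mkOb G.1
  end.

(* For X = pt the only possible value, the empty sequence, is the identity. *)
Definition CRL_pr (RR : relMonad) (LM : leftModule RR) (X : CRL_ob LM) :
    CRL_hom X (CRL_ft X) :=
  let: existT n G := X return CRL_hom X (CRL_ft X) in
  match n return forall G : Obn LM n, CRL_hom (mkOb G) (CRL_ft (mkOb G)) with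
  | 0 => fun _ => eta RR 0
  | k.+1 => fun _ (i : 'I_k) => eta RR k.+1 (iota1 i)
  end G.

Definition CRL_pullOb (RR : relMonad) (LM : leftModule RR) (X Y : CRL_ob LM) :
    0 < CRL_len Y -> CRL_hom X (CRL_ft Y) -> CRL_ob LM :=
  let: existT n G := Y return 0 < CRL_len Y -> CRL_hom X (CRL_ft Y) -> _ in
  match n return forall G : Obn LM n,
    0 < n -> CRL_hom X (CRL_ft (mkOb G)) -> CRL_ob LM with
  | 0 => fun _ pos0 _ => False_rect _ (notF pos0)
  | k.+1 => fun G _ f => @mkOb RR LM (CRL_len X).+1 (projT2 X, act f G.2)
  end G.

Definition CRL_pullq (RR : relMonad) (LM : leftModule RR) (X Y : CRL_ob LM) :
    forall (posY : 0 < CRL_len Y) (f : CRL_hom X (CRL_ft Y)),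
    CRL_hom (CRL_pullOb posY f) Y :=
  let: existT n G := Y return forall (posY : 0 < CRL_len Y)
    (f : CRL_hom X (CRL_ft Y)), CRL_hom (CRL_pullOb posY f) Y in
  match n return forall (G : Obn LM n) (posG : 0 < CRL_len (mkOb G))
    (f : CRL_hom X (CRL_ft (mkOb G))), CRL_hom (CRL_pullOb posG f) (mkOb G) with
  | 0 => fun _ pos0 _ => False_rect _ (notF pos0)
  | k.+1 => fun G _ f => qq f
  end G.

Definition CRL (RR : relMonad) (LM : leftModule RR) : csystemData :=
  @CSystemData (CRL_cat LM) (@CRL_len RR LM) (CRL_pt LM) (@CRL_ft RR LM)
    (@CRL_pr RR LM) (@CRL_pullOb RR LM) (@CRL_pullq RR LM).

Definition mb_cod (RR : relMonad) (LM : leftModule RR) : Type :=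
  {n : nat & (Obn LM n.+1 * RR n)%type}.

Definition mb_at (RR : relMonad) (LM : leftModule RR) (X : CRL LM) :
    0 < len X -> chom (ft X) X -> mb_cod LM :=
  let: existT n G := X
    return 0 < CRL_len X -> CRL_hom (CRL_ft X) X -> mb_cod LM in
  match n return forall G : Obn LM n,
    0 < n -> CRL_hom (CRL_ft (mkOb G)) (mkOb G) -> mb_cod LM with
  | 0 => fun _ pos0 _ => False_rect _ (notF pos0)
  | k.+1 => fun G _ s => existT _ k (G, s ord_max)
  end G.

Definition mb (RR : relMonad) (LM : leftModule RR) (t : tOb (CRL LM)) :
    mb_cod LM :=
  mb_at (proj1 (proj2_sig (projT2 t))) (proj1_sig (projT2 t)).

(* The morphism (x_0^n, ..., x_{n-1}^n, o) from ft(n+1, G) to (n+1, G). *)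
Definition sec_mor (RR : relMonad) (LM : leftModule RR) n (G : Obn LM n.+1)
    (o : RR n) : @chom (CRL LM) (@ft (CRL LM) (mkOb G)) (mkOb G) :=
  snoc (eta RR n) o.

Arguments sec_mor {RR LM n} G o.

Definition sec_in_tOb (RR : relMonad) (LM : leftModule RR) : Prop :=
  forall n (G : Obn LM n.+1) (o : RR n),
    @in_tOb (CRL LM) (mkOb G) (sec_mor G o).

Definition mb_inv (RR : relMonad) (LM : leftModule RR) (H : sec_in_tOb LM)
    (y : mb_cod LM) : tOb (CRL LM) :=
  let: existT n (G, o) := y in
  existT _ (mkOb G) (exist _ (sec_mor G o) (H n G o)).

(* Main.v *)
Require Import Defs.
From mathcomp Require Import all_boot.
From Stdlib Require Import FunctionalExtensionality ProofIrrelevance.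

Set Implicit Arguments.
Unset Strict Implicit.
Unset Printing Implicit Defensive.

(** A morphism ft(X) -> X with X = (n+1, G) is a sequence s of n+1 elements of
    RR(n).  The projection p_X is the sequence of the first n variables, and
    substituting s into a variable returns the corresponding entry of s
    ([eta_rho]); hence the composite of s and p_X is the sequence of the first
    n entries of s.  So s is a section of p_X exactly when these entries are
    x_0, ..., x_(n-1), which leaves s(n) free ([section_iff_snoc]): a section
    is determined by G and s(n), and every element of RR(n) occurs as s(n).
    Both cancellations follow by splitting a sequence of length n+1 into its
    first n entries and its last one. *)

Lemma snoc_max (T : Type) n (f : 'I_n -> T) (a : T) : snoc f a ord_max = a.
Proof. by rewrite /snoc unlift_none. Qed.

Lemma iota1_lift n (i : 'I_n) : iota1 i = lift ord_max i.
Proof. by apply: val_inj; exact: esym (lift_max i). Qed.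

Lemma snoc_iota1 (T : Type) n (f : 'I_n -> T) (a : T) :
  snoc f a \o @iota1 n = f.
Proof.
by apply: functional_extensionality => i; rewrite /= iota1_lift /snoc liftK.
Qed.

Lemma snoc_eta (T : Type) n (s : 'I_n.+1 -> T) :
  snoc (s \o @iota1 n) (s ord_max) = s.
Proof.
apply: functional_extensionality => i; rewrite /snoc.
by case: unliftP => [j ->|->] //=; rewrite iota1_lift.
Qed.

(** Substitution into the variables indexed by the image of f only reads the
    entries of s there: this is the unit law [eta_rho] restricted along f. *)
Lemma rho_Lfun (RR : relMonad) k m n (f : 'I_k -> 'I_m) (s : 'I_m -> RR n) :
  rho s \o Lfun RR f = s \o f.
Proof. by rewrite -[in RHS](eta_rho s). Qed.

(** The projection from (n+1, G) is the renaming sequence of [iota1], so the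
    section equation only constrains the first n entries of s. *)
Lemma section_iff_snoc (RR : relMonad) (LM : leftModule RR) n
    (G : Obn LM n.+1) (s : 'I_n.+1 -> RR n) :
  @in_tOb (CRL LM) (mkOb G) s <-> s = snoc (eta RR n) (s ord_max).
Proof.
pose X : CRL LM := mkOb G.
have comp_pr : @ccomp (CRL LM) (ft X) X (ft X) s (pr X) = s \o @iota1 n.
  exact: rho_Lfun.
rewrite /in_tOb -/X comp_pr; split=> [[_ sE]|->].
  by rewrite -[LHS]snoc_eta sE.
by split=> //; rewrite snoc_iota1.
Qed.

Lemma sec_mor_in_tOb (RR : relMonad) (LM : leftModule RR) : sec_in_tOb LM.
Proof. by move=> n G o; apply/section_iff_snoc; rewrite /sec_mor snoc_max. Qed.

Lemma mb_invK (RR : relMonad) (LM : leftModule RR) (H : sec_in_tOb LM) :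
  cancel (mb_inv H) (@mb RR LM).
Proof. by move=> [n [G o]]; rewrite /mb /= /sec_mor snoc_max. Qed.

Lemma mbK (RR : relMonad) (LM : leftModule RR) (H : sec_in_tOb LM) :
  cancel (@mb RR LM) (mb_inv H).
Proof.
(* The object of length 0 is excluded by the positivity clause of [in_tOb]. *)
move=> [[[|n] G] [s sP]]; first by case: (sP).
have sE := (section_iff_snoc G s).1 sP.
rewrite /mb /=; congr existT.
(* Two sections with the same underlying sequence may carry different proofs
   of the section equation; proof irrelevance identifies them. *)
apply: eq_sig_hprop => [t|]; first exact: proof_irrelevance.
by rewrite /= /sec_mor -sE.
Qed.

Theorem mainTheorem4 (RR : relMonad) (LM : leftModule RR) :
  bijective (@mb RR LM) /\
  exists H : (forall n (G : Obn LM n.+1) (o : RR n),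
                @in_tOb (CRL LM) (mkOb G) (sec_mor G o)),
    cancel (@mb RR LM) (mb_inv H) /\ cancel (mb_inv H) (@mb RR LM).
Proof.
pose H := @sec_mor_in_tOb RR LM.
split; first by exists (mb_inv H); [apply: mbK | apply: mb_invK].
by exists H; split; [apply: mbK | apply: mb_invK].
Qed.
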